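(* Let $F=\mathbb{F}_q$ be the finite field with $q$ elements and $P\in\mathbb{F}_q[t]$ a polynomial of degree $d\ge1$. With respect to the Haar measure on $\hat K$, for almost every $z\in\mathcal{O}=\mathbb{F}_q[[t^{-1}]]$ the exponents $n_i=n_i(z)$ of the generalized Schneider continued fraction of $z$ satisfy $$-\sum_{i=1}^{r}n_i\asymp_{q,d} r .$$ That is, there are constants $C_1,C_2>0$ depending only on $q$ and $d$ such that for almost every $z\in\mathcal{O}$ the expansion of $z$ is infinite and, for all sufficiently large $r$ (depending on $z$), $C_1 r\le -\sum_{i=1}^{r}n_i(z)\le C_2 r$.
   Context: Notation: $A=\mathbb{F}_q[t]$, $K=\mathbb{F}_q(t)$, $\hat K=\mathbb{F}_q(\!(t^{-1})\!)$, with valuation $\nu$ extending $\nu(f/g)=\deg(g)-\deg(f)$; $\mathcal{O}=\{z\in\hat K:\nu(z)\ge0\}$. $A_d=\{Q\in \mathbb{F}_q[t]:\deg Q<d\}$. Generalized Schneider continued fraction of $z\in\hat K^\times$: for $y\in\hat K^\times$ there is a unique pair $(f,n)\in A_d\times\mathbb{Z}$ with $\nu(yP^n-f)>0$ and $\nu(y)=nd-\deg(f)$. Put $z_1=z$. Given $z_i\ne0$, let $(f_i,n_i)=(f_i(z),n_i(z))$ be the pair attached to $y=1/z_i$, and put $z_{i+1}=\frac{P^{n_i}}{z_i}-f_i$. If $z_{i+1}=0$ the algorithm stops (the expansion is finite of length $i$); otherwise it continues. The expansion is infinite if the algorithm never stops. *)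

(* Defs.v *)
From HB Require Import structures.
From mathcomp Require Import all_boot all_order all_algebra zify ring.
From mathcomp Require Import all_classical all_reals all_analysis.

Set Implicit Arguments.
Unset Strict Implicit.
Unset Printing Implicit Defensive.
Import Order.TTheory GRing.Theory Num.Theory.

Local Open Scope classical_set_scope.
Local Open Scope ring_scope.

(* F((t^-1)): the coefficient of index k is that of t^-k, and the support is
   bounded below, so that the order of a series is its least index with a
   nonzero coefficient. *)
Definition vanishes_below (F : fieldType) (N : int) (f : int -> F) :=
  forall k : int, k < N -> f k = 0.

Record laurent (F : fieldType) := Laurent {
  lcoef :> int -> F;
  lcoef_bounded : exists N, vanishes_below N lcoef }.

Definition convolution (F : fieldType) (f g : int -> F) (n : int) : F :=
  \sum_(i \in [set: int]) f i * g (n - i).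

Section Convolution.
Variable F : fieldType.
Implicit Types f g h : int -> F.

Lemma vanishes_belowW N M f :
  N <= M -> vanishes_below M f -> vanishes_below N f.
Proof. by move=> NM fM k kN; apply: fM; apply: lt_le_trans NM. Qed.

Lemma convolutionE N M f g n K :
  vanishes_below N f -> vanishes_below M g -> n < N + M + K%:Z ->
  convolution f g n = \sum_(j < K) f (N + j%:Z) * g (n - (N + j%:Z)).
Proof.
move=> fN gM nK; rewrite /convolution.
pose r := [seq N + j%:Z | j <- iota 0 K].
have ru : uniq r.
  by rewrite map_inj_uniq ?iota_uniq// => i j /addrI [].
rewrite -(@fsbig_widen _ _ _ _ [set` r] setT)//.
  rewrite -fsbig_seq// /r big_map.
  by rewrite -(big_mkord xpredT (fun j : nat => f (N + j%:Z) * g (n - (N + j%:Z))))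
    /index_iota subn0.
move=> i [_ /= /negP ir]; have [iN|Ni] := ltP i N.
  by rewrite fN ?mul0r.
rewrite gM ?mulr0//.
rewrite ltNge; apply: contra ir => Mi; apply/mapP; exists `|i - N|%N.
  by rewrite mem_iota; lia.
lia.
Qed.

Lemma convolution_vanishes N M f g : vanishes_below N f ->
  vanishes_below M g -> vanishes_below (N + M) (convolution f g).
Proof.
by move=> fN gM k kNM; rewrite (convolutionE (K := 0) fN gM) ?big_ord0 ?addr0.
Qed.

Definition truncation f N K : {poly F} := \poly_(j < K) f (N + j%:Z).

Lemma convolution_truncation N M f g (k K : nat) : vanishes_below N f ->
  vanishes_below M g -> (k < K)%N -> convolution f g (N + M + k%:Z) =
    (truncation f N K * truncation g M K)`_k.
Proof.
move=> fN gM kK; rewrite (convolutionE (K := k.+1) fN gM); last by lia.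
rewrite coefM; apply: eq_bigr => -[j /= jk] _; rewrite !coef_poly.
rewrite !ifT; [|lia|lia]; congr (_ * g _); lia.
Qed.

Lemma truncationP N (P : int -> Prop) :
  (forall n : int, n < N -> P n) -> (forall k : nat, P (N + k%:Z)) -> forall n, P n.
Proof.
move=> PN Pk n; have [/PN//|Nn] := ltP n N.
by have -> : n = N + `|n - N|%N%:Z by lia.
Qed.

Lemma convolutionC f g : (exists N, vanishes_below N f) ->
  (exists M, vanishes_below M g) -> convolution f g = convolution g f.
Proof.
move=> [N fN] [M gM]; apply/funext; apply: (@truncationP (N + M)) => [n nNM|k].
  by rewrite (convolution_vanishes fN gM)// (convolution_vanishes gM fN)// addrC.
rewrite (convolution_truncation fN gM (ltnSn k)) [N + M]addrC.
by rewrite (convolution_truncation gM fN (ltnSn k)) mulrC.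
Qed.

Lemma convolutionA f g h : (exists N, vanishes_below N f) ->
  (exists M, vanishes_below M g) -> (exists L, vanishes_below L h) ->
  convolution f (convolution g h) = convolution (convolution f g) h.
Proof.
move=> [N fN] [M gM] [L hL].
have ghML := convolution_vanishes gM hL.
have fgNM := convolution_vanishes fN gM.
apply/funext; apply: (@truncationP (N + M + L)) => [n nNM|k].
  by rewrite (convolution_vanishes fgNM hL)// (convolution_vanishes fN ghML)// addrA.
rewrite (convolution_truncation fgNM hL (ltnSn k)) -[N + M + L]addrA.
rewrite (convolution_truncation fN ghML (ltnSn k)).
transitivity ((truncation f N k.+1 * truncation g M k.+1 *
   truncation h L k.+1)`_k).
  rewrite -mulrA !coefM; apply: eq_bigr => -[j /= jk] _.
  congr (_ * _); rewrite [LHS]coef_poly ifT; last by lia.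
  by rewrite (convolution_truncation gM hL (K := k.+1))//; lia.
rewrite !coefM; apply: eq_bigr => -[j /= jk] _.
by congr (_ * _); rewrite [RHS]coef_poly ifT// (convolution_truncation (K := k.+1) fN gM).
Qed.


Lemma convolutionDl f g h : (exists N, vanishes_below N f) ->
  (exists M, vanishes_below M g) -> (exists L, vanishes_below L h) ->
  convolution (fun n => f n + g n) h =
  (fun n => convolution f h n + convolution g h n).
Proof.
move=> [N' fN'] [M gM] [L hL]; pose N : int := Order.min N' M.
have fN : vanishes_below N f by apply: vanishes_belowW fN'; rewrite ge_min lexx.
have gN : vanishes_below N g by apply: vanishes_belowW gM; rewrite ge_min lexx orbT.
have fgN : vanishes_below N (fun n => f n + g n).
  by move=> k kN; rewrite fN ?gN ?addr0.
apply/funext => n; have nK : n < N + L + (absz (n - N - L)%R).+1%:Z by lia.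
rewrite (convolutionE fgN hL nK) (convolutionE fN hL nK) (convolutionE gN hL nK).
by rewrite -big_split; apply: eq_bigr => i _; rewrite mulrDl.
Qed.

Lemma vanishes_delta (a : F) :
  vanishes_below 0 (fun k : int => if k == 0 then a else 0).
Proof. by move=> k k0; rewrite lt_eqF. Qed.

Lemma convolution1 f : (exists N, vanishes_below N f) ->
  convolution (fun k : int => if k == 0 then 1 else 0) f = f.
Proof.
move=> [N fN]; apply/funext => n.
rewrite (convolutionE (K := `|n - N|.+1) (@vanishes_delta 1) fN); last by lia.
rewrite big_ord_recl /= mul1r big1 => [|i _]; last by rewrite mul0r.
by rewrite addr0; congr (f _); lia.
Qed.

Fixpoint inverse_coefs (a : nat -> F) (m : nat) : seq F :=
  if m is k.+1 then
    let s := inverse_coefs a k in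
    rcons s ((a 0)^-1 * ((k == 0)%:R - \sum_(i < k) a (k - i)%N * s`_i))
  else [::].

Lemma size_inverse_coefs a m : size (inverse_coefs a m) = m.
Proof. by elim: m => //= m IH; rewrite size_rcons IH. Qed.

Lemma nth_inverse_coefs a m i : (i < m)%N ->
  (inverse_coefs a m)`_i = (inverse_coefs a i.+1)`_i.
Proof.
elim: m => // m IH; rewrite ltnS leq_eqVlt => /predU1P[->//|im].
by rewrite [in LHS]/= nth_rcons size_inverse_coefs im IH.
Qed.

Lemma inverse_coefsE (a : nat -> F) : a 0%N != 0 -> exists b : nat -> F,
  forall k, \sum_(i < k.+1) a i * b (k - i)%N = (k == 0)%:R.
Proof.
move=> a0; exists (fun k => (inverse_coefs a k.+1)`_k) => k.
rewrite big_ord_recl subn0 /= nth_rcons size_inverse_coefs ltnn eqxx.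
rewrite mulVKf// -[RHS](subrK (\sum_(i < k) a (k - i)%N * (inverse_coefs a k)`_i)).
congr (_ + _); rewrite [RHS](reindex_inj rev_ord_inj); apply: eq_bigr => i _ /=.
have ik := ltn_ord i.
rewrite (@nth_inverse_coefs _ k); last by lia.
have -> : (k - (k - i.+1) = i.+1)%N by lia.
by rewrite /bump /= add1n.
Qed.

End Convolution.

Section LaurentField.
Variable F : fieldType.
Local Notation K := (laurent F).
Implicit Types x y z : K.

Lemma laurentP x y : x =1 y -> x = y.
Proof.
case: x y => f f0 [g g0] /= /funext fg; move: f0; rewrite fg => f0.
by congr Laurent; exact: Prop_irrelevance.
Qed.

HB.instance Definition _ := gen_eqMixin K.
HB.instance Definition _ := gen_choiceMixin K.

Lemma laurent0_bounded : exists N, vanishes_below N (fun=> 0 : F).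
Proof. by exists 0. Qed.

Lemma laurentN_bounded x : exists N, vanishes_below N (fun k => - x k).
Proof. by have [N xN] := lcoef_bounded x; exists N => k /xN ->; rewrite oppr0. Qed.

Lemma laurentD_bounded x y : exists N, vanishes_below N (fun k => x k + y k).
Proof.
have [N xN] := lcoef_bounded x; have [M yM] := lcoef_bounded y.
by exists (Order.min N M) => k; rewrite lt_min => /andP[/xN -> /yM ->]; rewrite addr0.
Qed.

Lemma laurentM_bounded x y : exists N, vanishes_below N (convolution x y).
Proof.
have [N xN] := lcoef_bounded x; have [M yM] := lcoef_bounded y.
by exists (N + M); exact: convolution_vanishes.
Qed.

Lemma laurentC_bounded (a : F) :
  exists N, vanishes_below N (fun k : int => if k == 0 then a else 0).
Proof. by exists 0; exact: vanishes_delta. Qed.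

Definition laurent_zero : K := Laurent laurent0_bounded.
Definition laurent_opp x : K := Laurent (laurentN_bounded x).
Definition laurent_add x y : K := Laurent (laurentD_bounded x y).
Definition laurent_one : K := Laurent (laurentC_bounded 1).
Definition laurent_mul x y : K := Laurent (laurentM_bounded x y).

Fact laurent_addA : associative laurent_add.
Proof. by move=> x y z; apply: laurentP => k /=; rewrite addrA. Qed.
Fact laurent_addC : commutative laurent_add.
Proof. by move=> x y; apply: laurentP => k /=; rewrite addrC. Qed.
Fact laurent_add0 : left_id laurent_zero laurent_add.
Proof. by move=> x; apply: laurentP => k /=; rewrite add0r. Qed.
Fact laurent_addN : left_inverse laurent_zero laurent_opp laurent_add.
Proof. by move=> x; apply: laurentP => k /=; rewrite addNr. Qed.

HB.instance Definition _ := GRing.isZmodule.Build K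
  laurent_addA laurent_addC laurent_add0 laurent_addN.

Fact laurent_mulA : associative laurent_mul.
Proof.
by move=> [f f0] [g g0] [h h0]; apply: laurentP => k /=; rewrite convolutionA.
Qed.
Fact laurent_mulC : commutative laurent_mul.
Proof. by move=> [f f0] [g g0]; apply: laurentP => k /=; rewrite convolutionC. Qed.
Fact laurent_mul1 : left_id laurent_one laurent_mul.
Proof. by move=> [f f0]; apply: laurentP => k /=; rewrite convolution1. Qed.
Fact laurent_mulDl : left_distributive laurent_mul +%R.
Proof.
by move=> [f f0] [g g0] [h h0]; apply: laurentP => k /=; rewrite convolutionDl.
Qed.
Fact laurent_neq01 : laurent_one != 0.
Proof.
by apply/eqP => /(congr1 (fun x : K => x 0)) /= /eqP; rewrite oner_eq0.
Qed.

HB.instance Definition _ := GRing.Zmodule_isComNzRing.Build K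
  laurent_mulA laurent_mulC laurent_mul1 laurent_mulDl laurent_neq01.

Lemma laurent0E k : (0 : K) k = 0. Proof. by []. Qed.
Lemma laurent1E k : (1 : K) k = if k == 0 then 1 else 0. Proof. by []. Qed.
Lemma laurentDE x y k : (x + y) k = x k + y k. Proof. by []. Qed.
Lemma laurentNE x k : (- x) k = - x k. Proof. by []. Qed.
Lemma laurentBE x y k : (x - y) k = x k - y k. Proof. by []. Qed.
Lemma laurentME x y : (x * y) = convolution x y :> (int -> F). Proof. by []. Qed.

Definition is_order x (n : int) := x n != 0 /\ vanishes_below n x.

Lemma is_order_ex x : x != 0 -> exists n, is_order x n.
Proof.
move=> x0; have [N xN] := lcoef_bounded x.
have ex : exists k : nat, x (N + k%:Z) != 0.
  apply: contrapT => /forallNP xk; move/eqP: x0; apply; apply: laurentP.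
  apply: (@truncationP N) => [n /xN//|k].
  by apply/eqP; apply: contrapT => /negP; exact: xk.
exists (N + (ex_minn ex)%:Z); case: ex_minnP => k xk mink; split=> //.
apply: (@truncationP N) => [n /xN//|j]; rewrite ltrD2l => jk.
by apply/eqP; apply: contraTT jk => /mink; lia.
Qed.

(* the inverse when it exists, and 0 otherwise *)
Definition laurent_inv x : K := xget 0 [set y | y * x = 1].

Fact laurent_mulVx x : x != 0 -> laurent_inv x * x = 1.
Proof.
move=> /is_order_ex[N [xN0 xN]].
suff [y yx] : exists y, y * x = 1 by rewrite /laurent_inv; case: xgetP => [_ ->|/(_ y)].
have [|b bP] := @inverse_coefsE _ (fun k => x (N + k%:Z)); first by rewrite addr0.
pose g (k : int) := if k < - N then 0 else b (absz (k + N)).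
have gN : vanishes_below (- N) g by move=> k kN; rewrite /g kN.
exists (Laurent (ex_intro _ (- N) gN)); rewrite mulrC; apply: laurentP.
rewrite laurentME /=; have xgN := convolution_vanishes xN gN.
apply: (@truncationP 0) => [n n0|k].
  by rewrite xgN ?subrr// lt_eqF.
rewrite -[X in convolution _ _ (X + _)](subrr N).
rewrite (convolution_truncation xN gN (ltnSn k)) coefM add0r.
transitivity (\sum_(i < k.+1) x (N + i%:Z) * b (k - i)%N).
  apply: eq_bigr => -[i /= ik] _; rewrite !coef_poly !ifT; [|lia|lia].
  congr (_ * _); rewrite /g ifF; last by lia.
  by congr (b _); lia.
by rewrite bP; case: k => [|k].
Qed.

Fact laurent_inv0 : laurent_inv 0 = 0.
Proof.
rewrite /laurent_inv; case: xgetP => // y _ /= /eqP.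
by rewrite mulr0 eq_sym oner_eq0.
Qed.

HB.instance Definition _ := GRing.ComNzRing_isField.Build K
  laurent_mulVx laurent_inv0.

End LaurentField.

Section Valuation.
Variable F : fieldType.
Local Notation K := (laurent F).
Implicit Types x y z : K.

(* The junk value 0 of xget is never reached, by is_order_ex. *)
Definition laurent_val x : \bar int :=
  if x == 0 then +oo%E else (xget 0 [set n | is_order x n])%:E.

Lemma is_order_neq0 x n : is_order x n -> x != 0.
Proof. by case=> xn _; apply: contraNneq xn => ->; rewrite laurent0E. Qed.

Lemma is_order_uniq x n m : is_order x n -> is_order x m -> n = m.
Proof.
move=> [xn nx] [xm mx]; apply/eqP; rewrite eq_le !leNgt; apply/andP; split.
  by apply: contraNN xm => /nx ->.
by apply: contraNN xn => /mx ->.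
Qed.

Lemma laurent_val_order x n : is_order x n <-> laurent_val x = n%:E.
Proof.
rewrite /laurent_val; split=> [xn|].
  rewrite (negbTE (is_order_neq0 xn)); congr (_%:E).
  by case: xgetP => [m _ /is_order_uniq|/(_ n)//]; exact.
case: eqVneq => // /is_order_ex[m xm] [<-].
by case: xgetP => [//|/(_ m)].
Qed.

Lemma laurent_val0 : laurent_val 0 = +oo%E. Proof. by rewrite /laurent_val eqxx. Qed.

Lemma le_laurent_val x n : (n%:E <= laurent_val x)%E <-> vanishes_below n x.
Proof.
have [->|x0] := eqVneq x 0; first by rewrite laurent_val0 leey; split.
have [m [xm mx]] := is_order_ex x0; have/laurent_val_order -> : is_order x m by [].
rewrite lee_fin; split=> [nm|nx]; first exact: vanishes_belowW mx.
by rewrite leNgt; apply: contraNN xm => /nx ->.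
Qed.

Lemma is_order1 : is_order (1 : K) 0.
Proof.
split; first by rewrite laurent1E eqxx oner_eq0.
by move=> k k0; rewrite laurent1E lt_eqF.
Qed.

Lemma is_orderM x y n m :
  is_order x n -> is_order y m -> is_order (x * y) (n + m).
Proof.
move=> [xn nx] [ym my]; split; last exact: convolution_vanishes.
rewrite laurentME -[n + m]addr0 (convolution_truncation nx my (ltnSn 0)).
by rewrite coefM big_ord1 !coef_poly !addr0 mulf_neq0.
Qed.

Lemma is_orderV x n : is_order x n -> is_order x^-1 (- n).
Proof.
move=> xn; have x0 := is_order_neq0 xn.
have [m xm] : exists m, is_order x^-1 m by apply: is_order_ex; rewrite invr_eq0.
have := is_orderM xn xm; rewrite mulfV// => /is_order_uniq/(_ is_order1) nm.
by have -> : - n = m by lia.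
Qed.

Lemma is_orderX x n (k : int) : is_order x n -> is_order (x ^ k) (k * n).
Proof.
move=> xn; have pos (j : nat) : is_order (x ^+ j) (j%:Z * n).
  elim: j => [|j IH]; first by rewrite mul0r expr0; exact: is_order1.
  by rewrite exprS (_ : _ * n = n + j%:Z * n); [exact: is_orderM|lia].
case: k => j; first exact: pos.
by rewrite NegzE mulNr; exact/is_orderV/pos.
Qed.

End Valuation.

Section Topology.
Variable F : fieldType.
Local Notation K := (laurent F).
Implicit Types x y z : K.

Definition vball x (n : int) : set K := [set y | (n%:E <= laurent_val (y - x)%R)%E].

Lemma vballP x n y : vball x n y <-> forall k, k < n -> y k = x k.
Proof.
rewrite /vball /= le_laurent_val; split=> yx k /yx.
  by rewrite laurentBE => /eqP; rewrite subr_eq0 => /eqP.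
by rewrite laurentBE => ->; rewrite subrr.
Qed.

Lemma vball_center x n : vball x n x. Proof. by apply/vballP. Qed.

HB.instance Definition _ := hasNbhs.Build K
  (fun x => filter_from [set: int] (vball x)).

Fact laurent_nbhs_filter x : ProperFilter (nbhs x).
Proof.
apply: filter_from_proper => [|n _]; last by exists x; exact: vball_center.
apply: filter_from_filter => [|n m _ _]; first by exists 0.
exists (Order.max n m) => // y /vballP yx; split; apply/vballP => k kn.
  by apply: yx; rewrite lt_max kn.
by apply: yx; rewrite lt_max kn orbT.
Qed.

Fact laurent_nbhs_singleton x (A : set K) : nbhs x A -> A x.
Proof. by move=> [n _]; apply; exact: vball_center. Qed.

Fact laurent_nbhs_nbhs x (A : set K) : nbhs x A -> nbhs x (nbhs^~ A).
Proof.
move=> [n _ nA]; exists n => // y /vballP yx; exists n => // z /vballP zy.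
by apply: nA; apply/vballP => k kn; rewrite zy ?yx.
Qed.

HB.instance Definition _ := Nbhs_isNbhsTopological.Build K
  laurent_nbhs_filter laurent_nbhs_singleton laurent_nbhs_nbhs.

Fact laurent_sub_continuous : continuous (fun x : K * K => x.1 - x.2).
Proof.
move=> [x y] A [n _ nA]; exists (vball x n, vball y n).
  by split; exists n.
by move=> [x' y'] [/vballP xx' /vballP yy']; apply: nA; apply/vballP => k kn;
   rewrite !laurentBE xx'// yy'.
Qed.

HB.instance Definition _ :=
  PreTopologicalNmodule_isTopologicalZmodule.Build K laurent_sub_continuous.

HB.instance Definition _ := isPointed.Build K 0.

HB.instance Definition _ := @isMeasurable.Build (sigma_display (@open K)) K
  <<s (@open K) >> (@sigma_algebra0 _ setT (@open K))
  (@sigma_algebraC K (@open K)) (@sigma_algebra_bigcup _ setT (@open K)).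

End Topology.

Local Open Scope ereal_scope.

(* Regularity is automatic: laurent F is second countable and locally compact
   when F is finite. *)
Definition is_haar (F : fieldType) (R : realType)
    (mu : {measure set (laurent F) -> \bar R}) :=
  [/\ forall (a : laurent F) (A : set (laurent F)), measurable A ->
        mu [set (a + x)%R | x in A] = mu A,
      forall C : set (laurent F), compact C -> mu C < +oo &
      forall U : set (laurent F), open U -> U !=set0 -> 0 < mu U].

Definition laurent_integers (F : fieldType) : set (laurent F) := [set z | 0 <= laurent_val z].

Definition poly_deg (F : fieldType) (Q : {poly F}) : \bar int :=
  if Q == 0%R then -oo else (size Q).-1%:Z%:E.

Section Schneider.
Variable F : fieldType.
Local Notation K := (laurent F).
Implicit Types (P f : {poly F}) (x y z : K).

Local Open Scope ring_scope.

Let coef_default (Q : {poly F}) (i : nat) : (size Q <= i)%N -> Q`_i = 0.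
Proof. exact: nth_default. Qed.

(* The embedding F[t] -> F((t^-1)): the index k <= 0 carries the coefficient
   of t^(-k). *)
Lemma poly_laurent_bounded (Q : {poly F}) :
  exists N, vanishes_below N (fun k : int => if k <= 0 then Q`_(absz k) else 0).
Proof.
exists (- (size Q)%:Z) => k kQ; rewrite ifT; last by lia.
by apply/coef_default; lia.
Qed.

Definition poly_laurent (Q : {poly F}) : K := Laurent (poly_laurent_bounded Q).

Definition schneider_spec P y (fn : {poly F} * int) :=
  let d := (size P).-1 in
  [/\ (poly_deg fn.1 < d%:Z%:E)%E,
      (0 < laurent_val (y * poly_laurent P ^ fn.2 - poly_laurent fn.1)%R)%E &
      laurent_val y = ((fn.2 * d%:Z)%:E - poly_deg fn.1)%E].

Lemma is_order_poly (Q : {poly F}) : Q != 0 ->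
  is_order (poly_laurent Q) (- (size Q).-1%:Z).
Proof.
move=> Q0; split=> [|k kQ]; rewrite /= ?ifT; try lia.
  by rewrite abszN absz_nat -/(lead_coef Q) lead_coef_eq0.
by apply/coef_default; have := size_poly_gt0 Q; rewrite Q0; lia.
Qed.

Lemma poly_laurentE (Q : {poly F}) (i : nat) : poly_laurent Q (- i%:Z) = Q`_i.
Proof. by rewrite /= ifT; [rewrite abszN absz_nat|lia]. Qed.

Lemma laurent_val_sub_poly x (f : {poly F}) :
  (0 < laurent_val (x - poly_laurent f)%R)%E <-> forall i : nat, x (- i%:Z) = f`_i.
Proof.
have -> : (0 < laurent_val (x - poly_laurent f)%R)%E =
    ((1 : int)%:E <= laurent_val (x - poly_laurent f)%R)%E.
  case: (laurent_val _) => [m| |]; rewrite ?leey ?ltey ?lte_fin ?lee_fin//.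
rewrite le_laurent_val; split=> [xf i|xf k k1].
  apply/eqP; rewrite -subr_eq0 -poly_laurentE -laurentBE; apply/eqP/xf; lia.
have -> : k = - (absz k)%:Z by lia.
by rewrite laurentBE poly_laurentE xf subrr.
Qed.

Lemma schneider_spec_uniq P y : (1 < size P)%N -> y != 0 ->
  exists! fn, schneider_spec P y fn.
Proof.
move=> P1 y0; have P0 : P != 0 by rewrite -size_poly_gt0; lia.
rewrite /schneider_spec; set d := (size P).-1.
have d0 : (0 < d)%N by rewrite /d; lia.
have [N yN] := is_order_ex y0; have /laurent_val_order valy := yN.
have Px k : is_order (y * poly_laurent P ^ k) (N + k * (- d%:Z)).
  by apply: is_orderM => //; exact/is_orderX/is_order_poly.
pose r := absz ((- N) %% d%:Z)%Z; pose n := - ((- N) %/ d%:Z)%Z.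
have r_ge0 : 0 <= ((- N) %% d%:Z)%Z by rewrite modz_ge0//; lia.
have r_ltd : ((- N) %% d%:Z)%Z < d%:Z by rewrite ltz_pmod//; lia.
have rd : (r < d)%N by rewrite /r; lia.
have nr : n * d%:Z = N + r%:Z.
  by have := divz_eq (- N) d%:Z; rewrite /n /r; lia.
pose w := y * poly_laurent P ^ n.
have [wr rw] : is_order w (- r%:Z).
  by have := Px n; rewrite (_ : N + _ = - r%:Z)//; lia.
pose f := \poly_(i < r.+1) w (- i%:Z).
have szf : size f = r.+1 by rewrite size_poly_eq.
have f0 : f != 0 by rewrite -size_poly_gt0 szf.
exists (f, n); split=> [|[g m] /= [gd /laurent_val_sub_poly gw vy]].
  rewrite /= /poly_deg (negbTE f0) szf /=; split.
  - by rewrite lte_fin; lia.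
  - apply/laurent_val_sub_poly => i; rewrite coef_poly; case: ltnP => // ri.
    by apply: rw; lia.
  - by rewrite valy nr -EFinB; congr (_%:E); lia.
have g0 : g != 0 by apply/eqP => g0; move: vy; rewrite /poly_deg g0 eqxx valy.
move: gd vy; rewrite /poly_deg (negbTE g0) valy lte_fin -EFinB.
move: (size g).-1 => s sd [vy].
have mn : m = n.
  have : (m - n) * d%:Z = s%:Z - r%:Z by lia.
  by move: sd rd d0; rewrite ltz_nat; nia.
congr (_, _) => //; apply/polyP => i; rewrite -gw mn coef_poly.
by case: ltnP => // ri; apply/esym/rw; lia.
Qed.

(* The pair attached to y, which exists and is unique for y != 0 by
   schneider_spec_uniq. *)
Definition schneider_pair P y : {poly F} * int :=
  xget (0, 0) [set fn | schneider_spec P y fn].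

Lemma schneider_pairP P y : (1 < size P)%N -> y != 0 ->
  schneider_spec P y (schneider_pair P y).
Proof.
move=> P1 y0; have [fn [fnP _]] := schneider_spec_uniq P1 y0.
by rewrite /schneider_pair; case: xgetP => // /(_ fn).
Qed.

(* z_i |-> z_(i+1) for z_i != 0; the algorithm stops at z_i = 0, where the value
   is meaningless. *)
Definition schneider_step P z : K :=
  let fn := schneider_pair P z^-1 in
  poly_laurent P ^ fn.2 / z - poly_laurent fn.1.

(* z_i, for i >= 1 *)
Definition schneider_rest P z (i : nat) : K := iter i.-1 (schneider_step P) z.

Definition schneider_exponent P z i : int :=
  (schneider_pair P (schneider_rest P z i)^-1).2.

Definition schneider_infinite P z : Prop :=
  forall i, (1 <= i)%N -> schneider_rest P z i != 0.

End Schneider.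

(* Main.v *)
(* With T the map z_i |-> z_(i+1) and q = #|F|, T maps the part of the sphere
   {nu = v} on which the digit f is constant into {nu >= 1} and expands distances
   there by exactly v + v %% d; there are (q - 1) q^(v %% d) such digits.  So if
   A has a finite cover by sets of diameters q^-k of total weight c, then
   {nu z = v, T z in A} has one of total weight (q - 1) q^-v c: the numbers
   -n_i = nu z_i %/ d behave like independent variables with geometric tails.
   Chernoff bounds for both tails of -(n_1 + ... + n_r) follow by induction on r,
   directly for the covers.  The upper tail is made to include the z whose
   expansion stops before r, so that Borel-Cantelli disposes of the finite
   expansions as well.  Haar measure enters only through the fact that a ball of
   radius q^-k has q^-k times the measure of O. *)
Require Import Defs.
From mathcomp Require Import all_boot all_order all_algebra zify ring lra.
From mathcomp Require Import all_classical all_reals all_analysis.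

Import Order.TTheory GRing.Theory Num.Theory.
Local Open Scope classical_set_scope.
Local Open Scope ring_scope.
Set Implicit Arguments.
Unset Strict Implicit.
Unset Printing Implicit Defensive.

(** * Finite covers and their weights *)

Section Covering.
Variables (F : finFieldType) (R : realType).
Local Notation K := (laurent F).
Implicit Types (A B : set K) (a b c : R).

Definition narrow A (k : nat) :=
  forall x y, A x -> A y -> vanishes_below k%:Z (x - y).

(** Inductive, so that covers pull back through the algorithm by induction, with no measurability to
    check. The weight [#|F|^-k] is the measure of a ball of that radius when O has measure 1. *)
Inductive covered : set K -> R -> Prop :=
| covered_narrow A k : narrow A k -> covered A (#|F|%:R ^- k)
| covered_set0 : covered set0 0
| coveredU A B a b : covered A a -> covered B b -> covered (A `|` B) (a + b)
| coveredS A B a b : A `<=` B -> a <= b -> covered B a -> covered A b.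

Lemma card_gt1 : 1 < #|F|%:R :> R.
Proof. by rewrite ltr1n; exact: card_finNzRing_gt1. Qed.

Lemma card_gt0 : 0 < #|F|%:R :> R.
Proof. exact: lt_trans card_gt1. Qed.

Lemma covered_vanishing k : covered [set z : K | vanishes_below k%:Z z] (#|F|%:R ^- k).
Proof.
by apply: covered_narrow => x y xk yk i ik; rewrite laurentBE xk// yk// subrr.
Qed.

Lemma covered_seq (T : eqType) (s : seq T) (A : T -> set K) c :
  (forall t, covered (A t) c) ->
  covered [set z : K | exists2 t, t \in s & A t z] ((size s)%:R * c).
Proof.
move=> Ac; elim: s => [|t s IH].
  by apply: coveredS covered_set0; [move=> z [] | rewrite mul0r].
apply: coveredS (coveredU (Ac t) IH).
  move=> z [u]; rewrite inE => /orP[/eqP->|us] Auz; [by left|].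
  by right; exists u.
by rewrite /= -[(size s).+1]add1n natrD mulrDl mul1r.
Qed.

Lemma covered_sum m n (A : nat -> set K) (c : nat -> R) :
  (forall v, (m <= v < n)%N -> covered (A v) (c v)) ->
  covered [set z : K | exists2 v, (m <= v < n)%N & A v z] (\sum_(m <= v < n) c v).
Proof.
elim: n => [|n IH] Ac.
  by apply: coveredS covered_set0; [move=> z [v]; lia | rewrite big_geq].
have [mn|nm] := leqP m n; last first.
  by apply: coveredS covered_set0; [move=> z [v]; lia | rewrite big_geq].
rewrite big_nat_recr//=; apply: coveredS (lexx _) (coveredU (IH _) (Ac n _)).
- move=> z [v /andP[mv]]; rewrite ltnS leq_eqVlt => /orP[/eqP ->|vn] Az.
    by right.
  by left; exists v => //; rewrite mv.
- by move=> v vn; apply: Ac; lia.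
- by lia.
Qed.

(** * A single step of the algorithm *)

Variables (P : {poly F}) (d : nat).
Hypotheses (szP : size P = d.+1) (d0 : (0 < d)%N).

Local Notation T := (schneider_step P).

Let szP1 : (1 < size P)%N. Proof. by rewrite szP. Qed.

(** The valuation condition reads [v = (-n) d + deg f] with [deg f < d], which is the Euclidean
    division of [v] by [d]. *)
Lemma schneider_pair_order (z : K) (v : nat) : is_order z v%:Z ->
  size (schneider_pair P z^-1).1 = (v %% d).+1 /\
  (schneider_pair P z^-1).2 = - (v %/ d)%:Z.
Proof.
move=> zv; have z0 := is_order_neq0 zv.
have V0 : z^-1 != 0 by rewrite invr_eq0.
have [+ _] := schneider_pairP szP1 V0.
have /laurent_val_order -> := is_orderV zv.
case: schneider_pair => f n /=; rewrite szP /= /poly_deg.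
case: eqVneq => [//|f0]; have := size_poly_gt0 f; rewrite f0.
case: (size f) => // s _ /=; rewrite lte_fin -EFinB ltz_nat => sd [nv].
have vn : v%:Z = s%:Z - n * d%:Z by lia.
have n0 : n <= 0 by nia.
have vE : v = (absz n * d + s)%N by nia.
by rewrite vE modnMDl divnMDl// modn_small// divn_small// addn0; split => //; lia.
Qed.

Lemma schneider_step_frac (z : K) : z != 0 -> vanishes_below 1 (T z).
Proof.
move=> z0; have V0 : z^-1 != 0 by rewrite invr_eq0.
have [_ + _] := schneider_pairP szP1 V0.
rewrite mulrC /schneider_step; set w := (X in laurent_val X).
move=> w0; apply/le_laurent_val; move: w0.
by case: (laurent_val w) => [m| |]; rewrite ?leey ?ltey ?lte_fin ?lee_fin.
Qed.

(* From T x - T y = P^n (y - x) / (x y): with n = - (v %/ d) and nu x = nu y = v,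
   T expands distances on a branch by exactly v + v %% d. *)
Lemma narrow_branch A k v (f : {poly F}) : narrow A k ->
  narrow [set z : K | [/\ is_order z v%:Z, (schneider_pair P z^-1).1 = f & A (T z)]]
    (k + (v + v %% d)).
Proof.
move=> Ak x y [xv xf Ax] [yv yf Ay].
have x0 := is_order_neq0 xv; have y0 := is_order_neq0 yv.
have [_ xn] := schneider_pair_order xv; have [_ yn] := schneider_pair_order yv.
have P0 : P != 0 by rewrite -size_poly_gt0 szP.
have := is_orderX (- (v %/ d)%:Z) (is_order_poly P0).
set p := _ ^ _ => pv.
have p0 := is_order_neq0 pv.
have -> : x - y = (T y - T x) * (x * y * p^-1).
  rewrite /schneider_step xf yf xn yn -/p; field; exact/and3P.
have [_ W] := is_orderM (is_orderM xv yv) (is_orderV pv).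
apply: vanishes_belowW (convolution_vanishes (Ak _ _ Ay Ax) W).
have := divn_eq v d; rewrite szP /=; lia.
Qed.

Definition polys_of_deg e : seq {poly F} :=
  [seq c *: 'X^e + rVpoly g | c : F <- enum [pred c : F | c != 0],
    g : 'rV[F]_e <- enum {: 'rV[F]_e}].

Lemma size_polys_of_deg e : size (polys_of_deg e) = ((#|F| - 1) * #|F| ^ e)%N.
Proof.
rewrite size_allpairs -!cardE card_mx mul1n; congr (_ * _)%N.
by have := cardC1 (0 : F); rewrite subn1.
Qed.

Lemma mem_polys_of_deg (f : {poly F}) e : size f = e.+1 -> f \in polys_of_deg e.
Proof.
move=> fe; apply/allpairsP; exists (lead_coef f, poly_rV (f - lead_coef f *: 'X^e)).
have szf : (size (f - lead_coef f *: 'X^e)%R <= e)%N.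
  apply/leq_sizeP => j; rewrite leq_eqVlt coefB coefZ coefXn => /orP[/eqP <-|ej].
    by rewrite eqxx mulr1 lead_coefE fe subrr.
  by rewrite nth_default ?fe// gtn_eqF// mulr0 subr0.
split; rewrite /= ?mem_enum//.
  by rewrite inE lead_coef_eq0 -size_poly_gt0 fe.
by rewrite poly_rV_K// addrC subrK.
Qed.

(** Each digit contributes weight [q^-(v + v %% d) c], by induction on the cover of [A]; the number
    of digits cancels [q^-(v %% d)]. *)
Lemma covered_branch A c v : covered A c ->
  covered [set z : K | is_order z v%:Z /\ A (T z)]
    ((#|F|%:R - 1) * #|F|%:R ^- v * c).
Proof.
move=> Ac; have q0 := card_gt0.
pose B A f := [set z : K | [/\ is_order z v%:Z, (schneider_pair P z^-1).1 = f & A (T z)]].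
have Bc f : covered (B A f) (#|F|%:R ^- (v + v %% d) * c).
  elim: Ac => {A c} [A k Ak||A A' a a' _ Ba _ Ba'|A A' a a' AA' aa' _ Ba].
  - rewrite -invfM -exprD addnC; exact/covered_narrow/narrow_branch.
  - by rewrite mulr0; apply: coveredS covered_set0 => // z [].
  - rewrite mulrDr; apply: coveredS (lexx _) (coveredU Ba Ba').
    by move=> z [zv zf [Az|Az]]; [left|right].
  - apply: coveredS Ba; first by move=> z [zv zf /AA'].
    by rewrite ler_pM2l// invr_gt0 exprn_gt0.
apply: coveredS (covered_seq (polys_of_deg (v %% d)) Bc).
  move=> z [zv Az]; exists (schneider_pair P z^-1).1 => //.
  by apply: mem_polys_of_deg; case: (schneider_pair_order zv).
rewrite size_polys_of_deg natrM natrB ?natrX; last exact/ltnW/card_finNzRing_gt1.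
rewrite le_eqVlt; apply/orP; left; apply/eqP; rewrite exprD; field.
by rewrite !expf_neq0// gt_eqF.
Qed.

(** * Sums of levels and their tails *)

Definition level z : nat := absz (schneider_pair P z^-1).2.

Fixpoint levels r z : nat :=
  if r is r'.+1 then (level z + levels r' (T z))%N else 0%N.

Fixpoint survives r z : Prop :=
  if r is r'.+1 then z != 0 /\ survives r' (T z) else True.

Lemma level_order z v : is_order z v%:Z -> level z = (v %/ d)%N.
Proof. by rewrite /level => /schneider_pair_order[_ ->]; rewrite abszN absz_nat. Qed.

Lemma vanishes_order N (z : K) : z != 0 -> vanishes_below N%:Z z ->
  exists2 v : nat, (N <= v)%N & is_order z v%:Z.
Proof.
move=> /is_order_ex[n [zn nz]] zN.
have Nn : N%:Z <= n by rewrite leNgt; apply: contraNN zn => /zN ->.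
exists (absz n); first by lia.
by have -> : (absz n)%:Z = n by lia.
Qed.

(* Includes the z for which some z_1, ..., z_r vanishes, since the junk values
   of [level] are then irrelevant. *)
Definition high r N := [set z : K | vanishes_below 0 z /\
  (survives r z -> (N <= levels r z)%N)].

(** The starting point is only known to lie in O ([m = 0]), while later iterates have order at least
    1 ([m = 1]). *)
Definition low m r N := [set z : K | [/\ vanishes_below m%:Z z,
  survives r z & (levels r z <= N)%N]].

(** Order at least [N d] makes the first level reach [N]; these points, and 0, go into one ball.
    Otherwise the later levels must supply the rest. *)
Lemma high_sub r N : high r.+1 N `<=` [set z : K | vanishes_below (N * d)%N%:Z z] `|`
  [set z : K | exists2 v, (0 <= v < N * d)%N &
    is_order z v%:Z /\ high r (N - v %/ d) (T z)].
Proof.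
move=> z [z0 hz]; have [->|zn0] := eqVneq z 0; first by left.
have [v _ zv] := vanishes_order zn0 z0.
have [Nv|vN] := leqP (N * d) v; [left|right].
  by case: zv => _; apply: vanishes_belowW; lia.
exists v => //; split => //; split.
  exact: vanishes_belowW (schneider_step_frac zn0).
move=> sz; have := hz (conj zn0 sz); rewrite /= (level_order zv); lia.
Qed.

Lemma low_sub m r N : low m r.+1 N `<=`
  [set z : K | exists2 v, (m <= v < N.+1 * d)%N &
    is_order z v%:Z /\ low 1 r (N - v %/ d) (T z)].
Proof.
move=> z [zm [zn0 sz] lz].
have [v mv zv] := vanishes_order zn0 zm.
move: lz; rewrite /= (level_order zv) => lz; exists v.
  by rewrite mv -ltn_divLR//; lia.
by split => //; split => //; [exact: schneider_step_frac|lia].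
Qed.

(** * Chernoff bounds for covers *)

Local Notation q := (#|F|%:R : R).

(** Telescoping of [(q - 1) q^-v = q (q^-v - q^-(v+1))]. The factor [q] normalizes the ball {nu >=
    1}, where the iterates lie, to weight 1. *)
Lemma sum_sphere_weights m n : (m <= n)%N ->
  \sum_(m <= v < n) (q - 1) * q ^- v = q * (q ^- m - q ^- n).
Proof.
move=> mn; have q0 := card_gt0.
rewrite -big_distrr /= -[_ ^- m - _]opprB.
rewrite -(telescope_sumr (fun v => q ^- v))// -sumrN !big_distrr /=.
apply: eq_bigr => v _; rewrite exprS; field.
by rewrite expf_neq0 ?gt_eqF.
Qed.

(* Chernoff bound with exponential weight (3/2)^(-n_i). *)
Lemma covered_high r N : covered (high r N) ((4 * q) ^+ r * (2 / 3) ^+ N).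
Proof.
have q1 := card_gt1; have q0 := card_gt0.
have q2 : 2 <= q by rewrite ler_nat; exact: card_finNzRing_gt1.
elim: r N => [|r IH] N.
  rewrite expr0 mul1r; case: N => [|N].
    by apply: coveredS (covered_vanishing 0); [move=> z []|rewrite !expr0 invr1].
  by apply: coveredS covered_set0 => [z [_ /(_ I)]//|]; rewrite exprn_ge0.
have step v : (0 <= v < N * d)%N -> covered
    [set z : K | is_order z v%:Z /\ high r (N - v %/ d) (T z)]
    ((q - 1) * q ^- v * ((4 * q) ^+ r * (2 / 3) ^+ (N - v %/ d))).
  by move=> _; exact/covered_branch.
apply: coveredS (coveredU (covered_vanishing (N * d)) (covered_sum step)).
  exact: high_sub.
set u : R := 2 / 3; set M := (4 * q) ^+ r.
have M1 : 1 <= M by rewrite exprn_ege1//; lra.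
have u0 : 0 < u by rewrite /u; lra.
have qW := ltW q0; have uW := ltW u0; have u1 : u <= 1 by rewrite /u; lra.
(* As [q >= 2], [q^-1 <= 1/2 = u * 3/4]: the factor [u] pays for the level, since [v %/ d <= v], and
   [3/4] makes the sum over [v] converge. *)
have qu : q^-1 <= u ^+ 2 * (9 / 8).
  have -> : u ^+ 2 * (9 / 8) = 2^-1 by rewrite /u; field.
  by rewrite lef_pV2 ?posrE.
have qu' : q^-1 <= u.
  apply: le_trans qu _; rewrite /u; lra.
have first_le : q ^- (N * d) <= u ^+ N.
  rewrite -exprVn; apply: le_trans (_ : u ^+ (N * d) <= _).
    by rewrite lerXn2r ?nnegrE ?invr_ge0 ?(ltW q0) ?(ltW u0).
  by apply: ler_wiXn2l; rewrite //; nia.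
have term_le v : (0 <= v < N * d)%N ->
    (q - 1) * q ^- v * (M * u ^+ (N - v %/ d)) <=
    (q - 1) * M * u ^+ N * (3 / 4) ^+ v.
  move=> vN; have vd : (v %/ d <= N)%N by rewrite ltnW// ltn_divLR//; lia.
  have -> : (q - 1) * q ^- v * (M * u ^+ (N - v %/ d)) =
    (q - 1) * M * (q ^- v * u ^+ (N - v %/ d)) by ring.
  rewrite -!mulrA !ler_pM2l ?subr_gt0// ?(lt_le_trans _ M1)//.
  have -> : u ^+ N = u ^+ (N - v %/ d) * u ^+ (v %/ d) by rewrite -exprD subnK.
  rewrite mulrC -mulrA ler_pM2l ?exprn_gt0//.
  apply: le_trans (_ : u ^+ v * (3 / 4) ^+ v <= _).
    rewrite -exprMn -exprVn lerXn2r ?nnegrE ?invr_ge0//.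
      by rewrite mulr_ge0//; lra.
    by apply: le_trans qu _; rewrite /u; lra.
  rewrite ler_pM2r ?exprn_gt0//.
  by apply: ler_wiXn2l; rewrite ?leq_div.
have geo n : \sum_(0 <= v < n) (3 / 4 : R) ^+ v <= 4.
  have -> : \sum_(0 <= v < n) (3 / 4 : R) ^+ v = 4 * (1 - (3 / 4) ^+ n).
    elim: n => [|n IHn]; first by rewrite big_geq// expr0; ring.
    by rewrite big_nat_recr//= IHn exprS; field.
  by have : 0 <= (3 / 4 : R) ^+ n by [rewrite exprn_ge0//; lra]; lra.
have sum_le : \sum_(0 <= v < N * d) (q - 1) * q ^- v * (M * u ^+ (N - v %/ d))
    <= (q - 1) * M * u ^+ N * 4.
  apply: le_trans (_ : _ <= \sum_(0 <= v < N * d) (q - 1) * M * u ^+ N * (3 / 4) ^+ v) _.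
    by rewrite big_nat_cond [leRHS]big_nat_cond ler_sum// => v /andP[/term_le].
  rewrite -big_distrr /= ler_wpM2l// !mulr_ge0 ?exprn_ge0//; lra.
apply: le_trans (lerD first_le sum_le) _.
rewrite exprS -/M; set w := u ^+ N; have w0 : 0 <= w by rewrite exprn_ge0 //.
(* Of the factor [4 q], the part [4 (q - 1)] bounds the spheres and the remaining 4 the ball. *)
have -> : 4 * q * M * w = M * w * 4 + (q - 1) * M * w * 4 by ring.
by rewrite lerD2r; nra.
Qed.

(* Chernoff bound with exponential weight 2^(n_i): q^-(d-1) is the probability
   of nu z_i >= d, that is, of n_i <> 0. *)
Lemma covered_low r N :
  covered (low 1 r N) ((1 - q ^- d.-1 / 2) ^+ r * 2 ^+ N).
Proof.
have q1 := card_gt1; have q0 := card_gt0; have qW := ltW q0; have q1W := ltW q1.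
set M := 1 - _; have x0 : 0 < q ^- d.-1 by rewrite invr_gt0 exprn_gt0.
have x1 : q ^- d.-1 <= 1 by rewrite -exprVn exprn_ile1 ?invr_ge0 ?invf_le1.
have M0 : 0 <= M by rewrite /M; lra.
elim: r N => [|r IH] N.
  rewrite expr0 mul1r; apply: coveredS (covered_vanishing 0).
    by move=> z [z1 _ _] /=; exact: vanishes_belowW z1.
  by rewrite expr0 invr1 exprn_ege1// ler1n.
have step v : (1 <= v < N.+1 * d)%N -> covered
    [set z : K | is_order z v%:Z /\ low 1 r (N - v %/ d) (T z)]
    ((q - 1) * q ^- v * (M ^+ r * 2 ^+ (N - v %/ d))).
  by move=> _; exact/covered_branch.
apply: coveredS (@low_sub 1 r N) _ (covered_sum step).
have dN : (d <= N.+1 * d)%N by lia.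
(* Orders [v < d] have level 0 and total weight [1 - q^-(d-1)]; orders [v >= d] weigh at most
   [q^-(d-1)], and their level, at least 1, gains a factor 1/2. *)
rewrite (@big_cat_nat _ _ _ d)//=.
set C := M ^+ r * 2 ^+ N; have C0 : 0 <= C by rewrite mulr_ge0 ?exprn_ge0 //.
have near_eq : \sum_(1 <= v < d) (q - 1) * q ^- v * (M ^+ r * 2 ^+ (N - v %/ d))
    = C * (1 - q ^- d.-1).
  have -> : 1 - q ^- d.-1 = q * (q ^- 1 - q ^- d).
    by rewrite expr1 -[in q ^- d](prednK d0) exprS; field; rewrite expf_neq0 gt_eqF.
  rewrite -sum_sphere_weights// big_distrr /= [LHS]big_nat [RHS]big_nat.
  by apply: eq_bigr => v /andP[_ vd]; rewrite divn_small// subn0 mulrC.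
have far_le : \sum_(d <= v < N.+1 * d) (q - 1) * q ^- v * (M ^+ r * 2 ^+ (N - v %/ d))
    <= C * (q ^- d.-1 / 2).
  apply: le_trans (_ : _ <= \sum_(d <= v < N.+1 * d) C / 2 * ((q - 1) * q ^- v)) _.
    rewrite [leLHS]big_nat [leRHS]big_nat ler_sum// => v /andP[dv vN].
    have v1 : (1 <= v %/ d)%N by rewrite divn_gt0.
    have vd : (v %/ d <= N)%N by rewrite -ltnS ltn_divLR.
    rewrite [leRHS]mulrC ler_wpM2l// ?mulr_ge0 ?invr_ge0 ?exprn_ge0 ?subr_ge0 //.
    rewrite /C -mulrA ler_wpM2l ?exprn_ge0 //.
    have -> : N = (N - v %/ d + (v %/ d).-1).+1 by lia.
    rewrite exprSr mulfK ?pnatr_eq0// ler_eXn2l ?ltr1n//; lia.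
  rewrite -big_distrr /= sum_sphere_weights// mulrAC -mulrA ler_wpM2l//.
  rewrite ler_pM2r ?invr_gt0// mulrBr.
  rewrite -[in q ^- d](prednK d0) exprS invfM mulrA divff ?gt_eqF// mul1r.
  by rewrite lerBlDr lerDl mulr_ge0 ?invr_ge0 ?exprn_ge0 //.
rewrite near_eq; apply: le_trans (lerD (lexx _) far_le) _.
by rewrite exprS -mulrA -/C /M -mulrDr mulrC; lra.
Qed.

(** The first point ranges over O rather than {nu >= 1}: its sphere weights sum to at most [q], its
    level is discarded, and [covered_low] handles the other [r] steps. *)
Lemma covered_low0 r N :
  covered (low 0 r.+1 N) (q * ((1 - q ^- d.-1 / 2) ^+ r * 2 ^+ N)).
Proof.
have q1 := card_gt1; have q0 := card_gt0; have qW := ltW q0; have q1W := ltW q1.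
set M := 1 - _.
have x1 : q ^- d.-1 <= 1 by rewrite -exprVn exprn_ile1 ?invr_ge0 ?invf_le1.
have M0 : 0 <= M by rewrite /M; lra.
have step v : (0 <= v < N.+1 * d)%N -> covered
    [set z : K | is_order z v%:Z /\ low 1 r (N - v %/ d) (T z)]
    ((q - 1) * q ^- v * (M ^+ r * 2 ^+ (N - v %/ d))).
  by move=> _; exact/covered_branch/covered_low.
apply: coveredS (@low_sub 0 r N) _ (covered_sum step).
set C := M ^+ r * 2 ^+ N; have C0 : 0 <= C by rewrite mulr_ge0 ?exprn_ge0 //.
apply: le_trans (_ : _ <= \sum_(0 <= v < N.+1 * d) C * ((q - 1) * q ^- v)) _.
  apply: ler_sum => v _.
  rewrite [leRHS]mulrC ler_wpM2l// ?mulr_ge0 ?invr_ge0 ?exprn_ge0 ?subr_ge0 //.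
  by rewrite ler_wpM2l ?exprn_ge0 // ler_eXn2l ?ltr1n// leq_subr.
rewrite -big_distrr /= sum_sphere_weights// mulrC ler_wpM2r// expr0 invr1.
by rewrite mulrBr mulr1 lerBlDr lerDl mulr_ge0 ?invr_ge0 ?exprn_ge0 //.
Qed.

(** * Exponent sums and exceptional sets *)

Lemma survives_iter r (z : K) : survives r z ->
  forall i, (i < r)%N -> iter i T z != 0.
Proof.
elim: r z => // r IH z [z0 sz] [|i] ir //.
by rewrite iterSr IH.
Qed.

Lemma sum_exponents r (z : K) : vanishes_below 0 z -> survives r z ->
  \sum_(1 <= i < r.+1) schneider_exponent P z i = - (levels r z)%:Z.
Proof.
elim: r z => [|r IH] z zO; first by rewrite big_geq.
move=> [z0 sz]; rewrite big_ltn// big_add1 /= PoszD opprD.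
have [v _ zv] := vanishes_order z0 zO.
congr (_ + _).
  rewrite (level_order zv) /schneider_exponent /schneider_rest /=.
  by case: (schneider_pair_order zv).
rewrite -IH//; last exact: vanishes_belowW (schneider_step_frac z0).
rewrite [LHS]big_nat [RHS]big_nat; apply: eq_bigr => -[//|i] _.
by rewrite /schneider_exponent /schneider_rest /= -iterSr.
Qed.

(** The upper and lower slopes are [n] and [1/k]. The index is [r.+1] because [covered_low0] needs a
    first step. *)
Definition exceptional k n r : set K := high r.+1 (n * r.+1) `|` low 0 r.+1 (r.+1 %/ k).

Lemma not_exceptional k n r (z : K) : vanishes_below 0 z -> ~ exceptional k n r z ->
  survives r.+1 z /\ (r.+1 %/ k < levels r.+1 z < n * r.+1)%N.
Proof.
move=> zO /not_orP[nh nl].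
have sz : survives r.+1 z by apply: contrapT => nsz; apply: nh; split.
split => //; rewrite !ltnNge; apply/andP; split; apply/negP => le.
  exact: nl.
by apply: nh; split.
Qed.

Lemma bernoulli_le (x : R) n : 0 <= x -> 1 + n%:R * x <= (1 + x) ^+ n.
Proof.
move=> x0; elim: n => [|n IH]; first by rewrite mul0r addr0 expr0.
rewrite exprS; apply: le_trans (_ : (1 + x) * (1 + n%:R * x) <= _).
  rewrite -natr1 -subr_ge0.
  have -> : (1 + x) * (1 + n%:R * x) - (1 + (n%:R + 1) * x) = n%:R * (x * x) by ring.
  by rewrite !mulr_ge0.
by rewrite ler_wpM2l// addr_ge0.
Qed.

Lemma covered_exceptional : exists a rho : R, 0 <= rho < 1 /\ forall r,
  covered (exceptional (2 * #|F| ^ d.-1).+1 (2 * (#|F| + 3)) r) (a * rho ^+ r).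
Proof.
have q1 := card_gt1; have q0 := card_gt0; have qW := ltW q0; have q1W := ltW q1.
pose x := q ^- d.-1 / 2; set k := (2 * _).+1; set n := (2 * _)%N.
have X1 : q ^- d.-1 <= 1 by rewrite -exprVn exprn_ile1 ?invr_ge0 ?invf_le1.
have X0 : 0 < q ^- d.-1 by rewrite invr_gt0 exprn_gt0.
have x0 : 0 < x by rewrite /x; lra.
have x1 : x <= 1 / 2 by rewrite /x; lra.
(* In the constant, 1 serves the upper tail and [2 q] the lower one, where [1 + x <= 2]. The rate
   [(1 - x)(1 + x)] is the Chernoff factor times a bound for [2^(1/k)]. *)
exists (1 + 2 * q), (1 - x ^+ 2); split; first by apply/andP; split; nra.
move=> r; apply: coveredS (coveredU (covered_high r.+1 (n * r.+1))
  (covered_low0 r (r.+1 %/ k))) => //.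
rewrite -/x [leRHS]mulrDl mul1r; apply: lerD.
  rewrite exprM -exprMn.
  (* The choice [n = 2 (q + 3)] works by [(2/3)^2 <= 1/2] and [q <= 2^q]; the summand 3 turns the
     factor 4 into 1/2. *)
  have half : 4 * q * (2 / 3) ^+ n <= 1 / 2.
    rewrite exprM; apply: le_trans (_ : 4 * q * (1 / 2) ^+ (#|F| + 3) <= _).
      rewrite ler_wpM2l ?mulr_ge0// lerXn2r ?nnegrE//; lra.
    rewrite expr_div_n expr1n exprD mulrA mul1r.
    rewrite ler_pdivrMr ?mulr_gt0 ?exprn_gt0//.
    have : q <= 2 ^+ #|F| by rewrite -natrX ler_nat ltnW// ltn_expl.
    by rewrite -[2 ^+ 3]/(2 * (2 * 2)); lra.
  have nn : 0 <= 4 * q * (2 / 3 : R) ^+ n by rewrite !mulr_ge0 ?exprn_ge0//; lra.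
  apply: le_trans (_ : (1 / 2) ^+ r <= _).
    rewrite exprSr; apply: le_trans (_ : (1 / 2) ^+ r * 1 <= _); last by rewrite mulr1.
    by apply: ler_pM; rewrite ?exprn_ge0 ?lerXn2r ?nnegrE//; lra.
  by rewrite lerXn2r ?nnegrE//; nra.
(* By Bernoulli, [k x >= 1] suffices, hence [k] just above [2 q^(d-1) = 1/x]. *)
have kx : 2 <= (1 + x) ^+ k.
  apply: le_trans (bernoulli_le k (ltW x0)).
  have -> : k%:R = 2 * q ^+ d.-1 + 1 :> R by rewrite /k -addn1 natrD natrM natrX.
  rewrite /x.
  have -> : 1 + (2 * q ^+ d.-1 + 1) * (q ^- d.-1 / 2) = 2 + q ^- d.-1 / 2.
    by field; rewrite expf_neq0// gt_eqF.
  by lra.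
have pow2 : 2 ^+ (r.+1 %/ k) <= (1 + x) ^+ r.+1.
  apply: le_trans (_ : (1 + x) ^+ (k * (r.+1 %/ k)) <= _).
    by rewrite exprM lerXn2r ?nnegrE//; lra.
  by rewrite ler_weXn2l//; [lra|rewrite mulnC leq_trunc_div].
have Mr0 : 0 <= (1 - x) ^+ r by rewrite exprn_ge0//; lra.
have -> : (1 - x ^+ 2) ^+ r = (1 - x) ^+ r * (1 + x) ^+ r.
  by rewrite -exprMn; congr (_ ^+ _); ring.
have -> : 2 * q * ((1 - x) ^+ r * (1 + x) ^+ r) =
  q * ((1 - x) ^+ r * (2 * (1 + x) ^+ r)) by ring.
rewrite ler_wpM2l// ler_wpM2l//; apply: le_trans pow2 _.
by rewrite exprS ler_wpM2r ?exprn_ge0//; lra.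
Qed.

End Covering.

(** * Ultrafilters and compactness of O *)

Lemma filter_forall_lt (T : Type) (G : set_system T) (FG : Filter G)
    (A : nat -> set T) n :
  (forall k, (k < n)%N -> G (A k)) -> G [set x | forall k, (k < n)%N -> A k x].
Proof.
elim: n => [|n IH] GA; first by apply: filterE.
have GAn := @filterI _ G FG _ _ (IH (fun k kn => GA k (ltnW kn))) (GA n (ltnSn n)).
apply: filterS GAn => x [Ax Anx] k; rewrite ltnS leq_eqVlt => /orP[/eqP ->//|].
exact: Ax.
Qed.

(** Otherwise [G] contains the complements of all the finitely many fibres of [h], whose
    intersection is empty. *)
Lemma ultra_finite_image (T : Type) (I : finType) (G : set_system T)
  (UG : UltraFilter G) (h : T -> I) : exists i, G [set x | h x = i].
Proof.
apply: contrapT => /forallNP nG.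
have : G [set x | forall i, i \in enum I -> h x != i].
  elim: (enum I) => [|i s IH]; first by apply: filterE.
  have [/nG//|Gi] := in_ultra_setVsetC [set x | h x = i] UG.
  apply: filterS (@filterI _ G _ _ _ IH Gi) => x [hs hi] j; rewrite inE => /orP[/eqP ->|/hs//].
  by apply/eqP.
move=> /filter_ex[x /(_ (h x))]; rewrite mem_enum => /(_ isT).
by rewrite eqxx.
Qed.

Section Haar.
Variables (F : finFieldType) (R : realType).
Local Notation K := (laurent F).
Local Open Scope ereal_scope.

Lemma laurent_integersE : @laurent_integers F = vball 0%R 0%R.
Proof. by apply/funext => z; rewrite /vball /laurent_integers/= subr0. Qed.

(** As [F] is finite, an ultrafilter on O fixes each coefficient on one of its members; the series
    so obtained is a limit, since a ball constrains only finitely many coefficients of a point of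
    O. *)
Lemma compact_laurent_integers : compact (@laurent_integers F).
Proof.
rewrite laurent_integersE compact_ultra => G UG GO.
have /choice[c Gc] := fun k : nat => ultra_finite_image UG (fun z : K => z k%:Z).
have x0 : vanishes_below 0 (fun k : int => if (k < 0)%R then 0%R else c (absz k)).
  by move=> k ->.
exists (Laurent (ex_intro _ 0%R x0)); split.
  by apply/vballP => k k0; exact: x0.
move=> A [n _ nA]; have PG : ProperFilter G by exact: ultra_proper.
suff : G A by [].
have FG := @filter_filter _ _ PG.
have Gn := @filterI _ G FG _ _ GO
  (@filter_forall_lt _ G FG _ (absz n) (fun k _ => Gc k)).
apply: (@filterS _ G FG _ _ _ Gn) => y [/vballP yO yc]; apply: nA.
apply/vballP => k kn /=; case: ltP => k0.
  by rewrite yO.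
have -> : k = (absz k)%:Z by lia.
by rewrite absz_nat yc//; lia.
Qed.

(** * Haar measure of balls and covers *)

Lemma open_vball (x : K) n : open (vball x n).
Proof.
rewrite openE => y /vballP yx; exists n => // z /vballP zy.
by apply/vballP => k kn; rewrite zy ?yx.
Qed.

Lemma measurable_vball (x : K) n : measurable (vball x n).
Proof. by apply: sub_sigma_algebra; exact: open_vball. Qed.

Fact monomial_bounded (c : F) (n : int) :
  exists N, vanishes_below N (fun k : int => if k == n then c else 0%R).
Proof. by exists n => k kn; rewrite lt_eqF. Qed.

Definition monomial c n : K := Laurent (monomial_bounded c n).

Lemma vball_translate (x : K) n : vball x n = [set (x + y)%R | y in vball 0%R n].
Proof.
apply/seteqP; split=> [y /vballP yx|_ [y /vballP y0 <-]]; last first.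
  by apply/vballP => k kn; rewrite laurentDE y0// laurent0E addr0.
exists (y - x)%R; last by rewrite addrC subrK.
by apply/vballP => k kn; rewrite laurentBE yx// subrr.
Qed.

Lemma vball0_split n :
  vball (0%R : K) n%:Z = \bigcup_(c in [set: F]) vball (monomial c n%:Z) n.+1%:Z.
Proof.
apply/seteqP; split=> [y /vballP y0|y [c _ /vballP yc]].
  exists (y n%:Z) => //; apply/vballP => k kn /=.
  by case: eqVneq => [->//|kn']; rewrite y0//; lia.
by apply/vballP => k kn; rewrite yc /=; [rewrite lt_eqF|lia].
Qed.

Variable mu : {measure set K -> \bar R}.
Hypothesis haar_mu : is_haar mu.

Lemma haar_vball (x : K) n : mu (vball x n) = mu (vball 0%R n).
Proof.
have [inv _ _] := haar_mu.
by rewrite vball_translate inv//; exact: measurable_vball.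
Qed.

(** The coefficient of index [n] splits the ball into [#|F|] disjoint translates of the next smaller
    one. *)
Lemma haar_vballS n : mu (vball 0%R n%:Z) = #|F|%:R%:E * mu (vball 0%R n.+1%:Z).
Proof.
rewrite vball0_split measure_fin_bigcup//=.
- rewrite (eq_fsbigr (fun=> mu (vball 0%R n.+1%:Z))); last first.
    by move=> c _; rewrite haar_vball.
  have -> : [set: F] = [set` enum F].
    by apply/seteqP; split => c //= _; rewrite mem_enum.
  rewrite -fsbig_seq ?enum_uniq// big_const_seq count_predT -cardE mule_natl.
  exact: iter_addr_0.
- move=> c c' _ _ [y [/vballP /(_ n%:Z) yc /vballP /(_ n%:Z) yc']].
  move: yc yc' => /=; rewrite eqxx => <-; last by lia.
  by move=> ->//; lia.
- by move=> c _; exact: measurable_vball.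
Qed.

Lemma haar_integers : exists2 m : R, (0 <= m)%R &
  forall x n, mu (vball x n%:Z) = (m / #|F|%:R ^+ n)%:E.
Proof.
have [_ cpt _] := haar_mu.
have fin : mu (vball 0%R 0%R) \is a fin_num.
  by rewrite ge0_fin_numE// -laurent_integersE cpt//; exact: compact_laurent_integers.
exists (fine (mu (vball 0%R 0%R))); first exact: fine_ge0.
move=> x n; rewrite haar_vball; have q0 : #|F|%:R != 0%R :> R.
  by rewrite pnatr_eq0 -lt0n; apply/card_gt0P; exists 0%R.
elim: n => [|n IH]; first by rewrite expr0 divr1 fineK.
have : (#|F|%:R^-1%:E * mu (vball 0%R n%:Z) = mu (vball 0%R n.+1%:Z)).
  by rewrite haar_vballS muleA -EFinM mulVf// mul1e.
by rewrite IH => <-; rewrite -EFinM; congr (_%:E); rewrite exprS invfM; ring.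
Qed.

(** Covered sets may fail to be measurable, hence the hull [V]: a nonempty narrow set lies in the
    ball around any of its points. *)
Lemma covered_measure : exists2 m : R, (0 <= m)%R & forall (A : set K) c,
  covered A c -> exists V, [/\ measurable V, A `<=` V & mu V <= (m * c)%:E].
Proof.
have [m m0 muE] := haar_integers; exists m => // A c.
elim=> {A c} [A k Ak||A B a b _ [V [mV AV Va]] _ [W [mW BW Wb]]|
    A B a b AB ab _ [V [mV BV Va]]].
- have [->|/set0P[x Ax]] := eqVneq A set0.
    exists set0; split; rewrite ?measure0 ?lee_fin//.
    by rewrite mulr_ge0 ?invr_ge0 ?exprn_ge0.
  exists (vball x k%:Z); split; [exact: measurable_vball| |by rewrite muE].
  by move=> y Ay; apply/le_laurent_val; exact: Ak.
- by exists set0; split; rewrite ?measure0 ?mulr0.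
- exists (V `|` W); split; [exact: measurableU|exact: setUSS|].
  apply: le_trans (measureU2 _ _ _) _ => //.
  by rewrite mulrDr EFinD leeD.
- exists V; split=> //; first exact: subset_trans BV.
  by apply: le_trans Va _; rewrite lee_fin ler_wpM2l.
Qed.

(** Borel-Cantelli for measurable hulls of the [A n], whose measures are dominated by a geometric
    series. *)
Lemma covered_geometric_negligible (A : nat -> set K) (a rho : R) :
  (0 <= rho < 1)%R -> (forall n, covered (A n) (a * rho ^+ n)) ->
  mu.-negligible (lim_sup_set A).
Proof.
move=> /andP[rho0 rho1] Aa; have [m m0 cov] := covered_measure.
have /choice[V VP] := fun n => cov _ _ (Aa n).
have mV n : measurable (V n) by have [] := VP n.
exists (lim_sup_set V); split.
- by apply: bigcap_measurable => // n _; exact: bigcup_measurable.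
- apply: lim_sup_set_cvg0 => //.
  apply: (@le_lt_trans _ _ (m * `|a| / (1 - rho))%:E); last exact: ltey.
  apply: lime_le; first exact: is_cvg_nneseries.
  apply: nearW => n.
  apply: (@le_trans _ _ (\sum_(0 <= k < n) (m * `|a| * rho ^+ k)%:E)).
    apply: lee_sum => k _; have [_ _ /le_trans] := VP k; apply.
    by rewrite lee_fin mulrA ler_wpM2r ?exprn_ge0// ler_wpM2l// ler_norm.
  rewrite sumEFin lee_fin -big_distrr /= ler_wpM2l ?mulr_ge0//.
  rewrite -div1r ler_pdivlMr ?subr_gt0//.
  have -> : ((\sum_(0 <= k < n) rho ^+ k) * (1 - rho) = 1 - rho ^+ n)%R.
    by rewrite big_mkord -[RHS]opprB subrX1 -mulNr opprB mulrC.
  by rewrite gerBl exprn_ge0.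
- move=> z Az n _; have [j nj Ajz] := Az n I; exists j => //.
  by have [_ + _] := VP j; exact.
Qed.

End Haar.

(** * Growth of the exponent sums almost everywhere *)

Theorem theorem1p3 (R : realType) (q d : nat) (hd : (1 <= d)%N) :
  exists C1 C2 : R, [/\ 0 < C1, 0 < C2 &
    forall (F : finFieldType) (P : {poly F})
      (mu : {measure set (laurent F) -> \bar R}),
      #|F| = q -> poly_deg P = (d%:Z)%:E -> is_haar mu ->
      \forall z \ae mu, laurent_integers z ->
        schneider_infinite P z /\
        \forall r \near \oo,
          C1 * r%:R <= - (\sum_(1 <= i < r.+1) schneider_exponent P z i)%:~R
            <= C2 * r%:R].
Proof.
(* The slopes of [covered_exceptional], written with [q] since [F] is not yet given. *)
pose k (e : nat) := (2 * q ^ e).+1.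
exists (k d.-1)%:R^-1, (2 * (q + 3))%:R; split.
- by rewrite invr_gt0 ltr0n.
- by rewrite ltr0n; lia.
move=> F P mu Fq degP haar_mu.
have szP : size P = d.+1.
  move: degP; rewrite /poly_deg; case: eqVneq => // P0 [sP].
  by rewrite -sP prednK ?size_poly_gt0.
have [a [rho [rhoP cov]]] := covered_exceptional R szP hd.
apply: negligibleS (covered_geometric_negligible haar_mu rhoP cov).
(* A point outside the limit superior avoids [exceptional] at every index from some [n] on. *)
move=> z /= zbad; apply: contrapT => /existsNP[n /existsNP[_ nz]].
apply: zbad => zO'.
have zO : vanishes_below 0 z by apply/le_laurent_val.
have good r : (n <= r)%N -> survives P r.+1 z /\
    (r.+1 %/ k d.-1 < levels P r.+1 z < 2 * (q + 3) * r.+1)%N.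
  move=> nr; rewrite /k -Fq; apply: not_exceptional zO _ => Er.
  by apply: nz; exists r.
split=> [i i1|].
  have [sz _] := good (maxn n i) (leq_maxl _ _).
  by apply: survives_iter sz _ _; lia.
(* The bounds at index [r] concern [r.+1] exponents, whence the start at [n.+1]. *)
exists n.+1 => // -[//|r] /= nr; have [sz /andP[lo hi]] := good r nr.
rewrite (sum_exponents szP hd zO sz) mulrNz opprK -pmulrn.
apply/andP; split.
  rewrite ler_pdivrMl ?ltr0n// -natrM ler_nat; move: lo.
  by rewrite ltn_divLR//; lia.
by rewrite -natrM ler_nat ltnW.
Qed.
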